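(* For every (fixed) graph $H$ there is a strategy $\sigma$ for the USTSR process such that $\tau(\sigma, \mathcal P'_H)\le d_{\min}(H) n + o(n)$ with high probability.
   Context: The USTSR process on $n$ vertices: let $V_n=\{v_1,\dots,v_n\}$ be the vertex set of $K_n$, $E_n$ its edge set, $\mathcal T_n$ the set of spanning trees of $K_n$. Starting from the empty graph on $V_n$, at each round $i\ge1$ a tree $T_i$ is sampled uniformly from $\mathcal T_n$ independently of previous rounds, and Builder adds an edge of $T_i$ of his choice (if not already present). A strategy is a map $\sigma:2^{E_n}\times\mathcal T_n\to E_n$ with $\sigma(F,T)\in E(T)$, used to choose the edge given the current edge set $F$ and current tree $T$; $G_{\sigma,i}$ is the graph after round $i$, and for a family $\mathcal P$ of graphs on $V_n$, $\tau(\sigma,\mathcal P)=\min\{i\ge0: G_{\sigma,i}\in\mathcal P\}$. $\mathcal P'_H$ is the family of graphs on $V_n$ in which every vertex lies in a copy of $H$; $d_{\min}(H)$ is the minimum degree of $H$. ''With high probability'' means with probability tending to $1$ as $n\to\infty$. *)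

(* Defs.v *)
From HB Require Import structures.
From mathcomp Require Import all_boot all_order all_algebra.
From mathcomp Require Import all_classical all_reals all_analysis.
From mathcomp Require Import Rstruct Rstruct_topology.
From Stdlib Require Import Rdefinitions.
Set Implicit Arguments. Unset Strict Implicit. Unset Printing Implicit Defensive.
Import Order.TTheory GRing.Theory Num.Theory.
Local Open Scope ring_scope.

(* Vertices of K_n are 'I_n; an edge is a 2-element subset of 'I_n;
   a graph on V_n is given by its edge set : {set {set 'I_n}}. *)

Definition is_edge (n : nat) (e : {set 'I_n}) : bool := #|e| == 2.

Definition adj (n : nat) (F : {set {set 'I_n}}) : rel 'I_n :=
  fun x y => [set x; y] \in F.

Definition is_spanning_tree (n : nat) (T : {set {set 'I_n}}) : bool :=
  [forall e in T, is_edge e] &&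
  [forall x, forall y, connect (adj T) x y] &&
  (#|T| == n.-1).

Definition stree (n : nat) := {T : {set {set 'I_n}} | is_spanning_tree T}.

(* a strategy: given current edge set F and current tree T, an edge *)
Definition strategy (n : nat) :=
  {set {set 'I_n}} -> {set {set 'I_n}} -> {set 'I_n}.

Definition valid_strategy (n : nat) (sigma : strategy n) : Prop :=
  forall (F T : {set {set 'I_n}}), is_spanning_tree T -> sigma F T \in T.

Definition graph_after (n : nat) (sigma : strategy n) (s : seq {set {set 'I_n}})
  : {set {set 'I_n}} :=
  foldl (fun G T => G :|: [set sigma G T]) finset.set0 s.

Definition simple_graph (V : finType) (EH : {set {set V}}) : Prop :=
  forall e, e \in EH -> #|e| = 2.

(* minimum degree d_min(H) (for nonempty V; the seed #|V| exceeds every degree) *)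
Definition deg (V : finType) (EH : {set {set V}}) (x : V) : nat :=
  #|[set e in EH | x \in e]|.
Definition dmin (V : finType) (EH : {set {set V}}) : nat :=
  \big[minn/#|V|]_(x : V) deg EH x.

Definition in_PH (V : finType) (EH : {set {set V}}) (n : nat)
  (G : {set {set 'I_n}}) : bool :=
  [forall v : 'I_n, exists phi : {ffun V -> 'I_n},
     [&& injectiveb phi, v \in codom phi &
         [forall e in EH, (phi @: e) \in G]]].

Definition tau_le_event (V : finType) (EH : {set {set V}}) (n : nat)
  (sigma : strategy n) (t : nat) : {set t.-tuple (stree n)} :=
  [set w : t.-tuple (stree n) |
     [exists i : 'I_t.+1, in_PH EH (graph_after sigma (map val (take i w)))]].

(* P[tau(sigma, P'_H) <= t], the T_i being independent and uniform on \mathcal T_n *)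
Definition prob_tau_le (V : finType) (EH : {set {set V}}) (n : nat)
  (sigma : strategy n) (t : nat) : R :=
  ((#|tau_le_event EH sigma t|)%:R / (#|{: t.-tuple (stree n)}|)%:R)%R.

(* Main.v *)
(* A builder who aims only at sets of useful edges X meets a uniform tree in X with
   probability at least mu/(1 + mu), mu = 2|X|/n. This is the second moment method:
   an edge switching injection shows P(ab in T, E included in T) <=
   (2/n) P(E included in T) when ab is not in E, so distinct edges are not
   positively correlated. The expected number of wasted rounds is therefore at most
   the sum of n/(2|X|) over the useful rounds, and Markov's inequality leaves a
   deterministic game: reach the goal with d_min n + o(n) useful rounds, the
   adversary picking the edge in the offered X, with the sum of 1/|X| being o(1).

   For the game let K = |V(H)| - 1. First build a tree of cliques of height K in
   which every node has N polylogarithmic children: nested stars give common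
   neighbourhoods shrinking by a power of N at each level, which costs only o(n).
   Then attach every vertex v to the first d_min vertices of a branch, one vertex of
   the branch at a time. While j attachments are missing, about jN/d_min edges are
   useful, so the costs add up to O(log n / N). Each v then plays the role of a
   vertex of minimum degree, the clique hosting the rest of H. *)
Require Import Defs.
From HB Require Import structures.
From mathcomp Require Import all_boot all_order all_algebra.
From mathcomp Require Import zify ring lra.
Set Implicit Arguments. Unset Strict Implicit. Unset Printing Implicit Defensive.
Import Order.TTheory GRing.Theory Num.Theory.

(** * Uniform spanning trees of the complete graph *)

Lemma set2_inj (T : finType) (a b u w : T) :
  [set u; w] = [set a; b] -> (u = a /\ w = b) \/ (u = b /\ w = a).
Proof.
move=> E.
have /set2P Hu : u \in [set a; b] by rewrite -E set21.
have /set2P Hw : w \in [set a; b] by rewrite -E set22.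
have /set2P Ha : a \in [set u; w] by rewrite E set21.
have /set2P Hb : b \in [set u; w] by rewrite E set22.
by intuition (subst; auto).
Qed.

Section Trees.
Variable n : nat.
Implicit Types (F G T E : {set {set 'I_n}}) (a b u w x y z : 'I_n).

Lemma adj_sym F : symmetric (adj F).
Proof. by move=> x y; rewrite /adj setUC. Qed.

Lemma connect_adjC F x y : connect (adj F) x y = connect (adj F) y x.
Proof. exact: (sym_connect_sym (adj_sym F)). Qed.

Lemma connect_adjS F G x y :
  F \subset G -> connect (adj F) x y -> connect (adj G) x y.
Proof.
move=> /subsetP sFG; apply: connect_sub => {}x {}y xy.
by apply: connect1; apply: sFG.
Qed.

(** Induction along the walk. Crossing [ab] a second time returns to an end already reached, so one
    crossing always suffices. *)
Lemma connect_del_edge F a b u w (G := F :\ [set a; b]) :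
  connect (adj F) u w ->
  [\/ connect (adj G) u w,
      connect (adj G) u a /\ connect (adj G) b w |
      connect (adj G) u b /\ connect (adj G) a w].
Proof.
move=> /connectP[p pP ->] {w}; elim: p u pP => [|v p IH] u /=.
  by move=> _; apply: Or31; apply: connect0.
case/andP=> uv /IH{}IH.
have [/set2_inj[[uE vE]|[uE vE]]|uvab] := eqVneq [set u; v] [set a; b].
- rewrite {}vE in IH *; rewrite {}uE; case: IH => [vw|[_ bw]|[_ aw]].
  + by apply: Or32; split=> //; apply: connect0.
  + by apply: Or32; split=> //; apply: connect0.
  + by apply: Or31.
- rewrite {}vE in IH *; rewrite {}uE; case: IH => [vw|[_ bw]|[_ aw]].
  + by apply: Or33; split=> //; apply: connect0.
  + by apply: Or31.
  + by apply: Or33; split=> //; apply: connect0.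
have cuv : connect (adj G) u v.
  by apply: connect1; rewrite /adj /G !inE uvab.
case: IH => [vw|[va bw]|[vb aw]].
- by apply: Or31; apply: connect_trans vw.
- by apply: Or32; split=> //; apply: connect_trans va.
- by apply: Or33; split=> //; apply: connect_trans vb.
Qed.

(** Induction on the number of edges: deleting an edge creates at most one new component. Components
    are counted by their roots. *)
Lemma card_components F :
  (forall e, e \in F -> is_edge e) ->
  n <= #|F| + #|[set fingraph.root (adj F) x | x : 'I_n]|.
Proof.
move: {2}#|F| (erefl #|F|) => m; elim: m F => [|m IH] F Fm Fe.
  have F0 : F = finset.set0 by apply/eqP; rewrite -cards_eq0 Fm.
  rewrite card_in_imset ?cardsT ?card_ord ?leq_addl // => x y _ _ /eqP.
  rewrite (root_connect (sym_connect_sym (adj_sym F))) => /connectP[[//|z p] /=].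
  by rewrite /adj F0 inE.
have /card_gt0P[e eF] : 0 < #|F| by rewrite Fm.
have /cards2P[a [b [ab eE]]] := Fe _ eF.
have := cardsD1 e F; rewrite eF Fm add1n => -[cF].
have := IH (F :\ e) (esym cF).
have He : forall e0, e0 \in F :\ e -> is_edge e0.
  by move=> e0; rewrite !inE => /andP[_ /Fe].
move=> /(_ He) H; apply: (leq_trans H); rewrite -cF addSn -addnS leq_add2l.
set A := [set _ | _ in _]; set B := [set _ | _ in _].
pose rb := fingraph.root (adj (F :\ e)) b.
rewrite (cardsD1 rb A) -[X in _ <= X]add1n leq_add ?leq_b1 //.
(* Putting [e] back merges only the components of [a] and [b], so taking roots in [F] is injective
   once the component of [b] is left out. *)
have -> : #|A :\ rb| = #|[set fingraph.root (adj F) x | x in A :\ rb]|.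
  rewrite card_in_imset // => x y; rewrite !inE.
  move=> /andP[xb /imsetP[x' _ xE]] /andP[yb /imsetP[y' _ yE]] /eqP.
  have symC := sym_connect_sym (adj_sym (F :\ e)).
  rewrite (root_connect (sym_connect_sym (adj_sym F))) => cxy.
  have rx : fingraph.root (adj (F :\ e)) x = x by rewrite xE root_root.
  have ry : fingraph.root (adj (F :\ e)) y = y by rewrite yE root_root.
  have := connect_del_edge a b cxy; rewrite -eE => -[] .
  + by rewrite -(root_connect symC) rx ry => /eqP.
  + by case=> _; rewrite -(root_connect symC) ry eq_sym (negPf yb).
  + by case; rewrite -(root_connect symC) rx (negPf xb).
apply: subset_leq_card; apply/subsetP => _ /imsetP[x _ ->].
by apply: imset_f.
Qed.

Lemma connected_card F x :
  (forall e, e \in F -> is_edge e) -> (forall y, connect (adj F) x y) ->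
  n.-1 <= #|F|.
Proof.
move=> Fe Fc; have := card_components Fe.
suff -> : [set fingraph.root (adj F) y | y : 'I_n] = [set fingraph.root (adj F) x].
  by rewrite cards1; lia.
apply/setP => y; rewrite !inE; apply/imsetP/eqP => [[z _ ->]|->]; last by exists x.
by apply/eqP; rewrite (root_connect (sym_connect_sym (adj_sym F))) connect_adjC.
Qed.

Lemma spanning_treeP T :
  reflect [/\ forall e, e \in T -> is_edge e,
              forall x y, connect (adj T) x y & #|T| = n.-1]
          (is_spanning_tree T).
Proof.
apply: (iffP andP) => [[/andP[/forall_inP h1 /'forall_forallP h2] /eqP h3]|[h1 h2 h3]] //.
split; last exact/eqP; apply/andP; split; first exact/forall_inP.
exact/'forall_forallP.
Qed.

(** Otherwise [n - 2] edges would connect all vertices, against [connected_card]. *)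
Lemma tree_del_edge T a b : is_spanning_tree T -> [set a; b] \in T ->
  ~~ connect (adj (T :\ [set a; b])) a b.
Proof.
move=> /spanning_treeP[Te Tc Tn] abT; apply/negP => cab.
have cardT : n.-1 = #|T :\ [set a; b]|.+1 by rewrite -Tn (cardsD1 [set a; b]) abT.
have De e : e \in T :\ [set a; b] -> is_edge e.
  by rewrite !inE => /andP[_ /Te].
suff /(connected_card De) : forall y, connect (adj (T :\ [set a; b])) a y.
  by rewrite cardT ltnn.
move=> y; case: (connect_del_edge a b (Tc a y)) => [//|[_ by_]|[_ //]].
exact: connect_trans by_.
Qed.

Lemma tree_del_cover T a b z : is_spanning_tree T ->
  connect (adj (T :\ [set a; b])) a z || connect (adj (T :\ [set a; b])) b z.
Proof.
move=> /spanning_treeP[_ Tc _].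
by case: (connect_del_edge a b (Tc a z)) => [->|[_ ->]|[_ ->]] //; rewrite orbT.
Qed.

(** The edge switching: the end of [ab] at [a] moves to the vertex [p.2]. It is applied with [p.2]
    on the side of [a] after the deletion of [ab], so that a tree stays a tree. *)
Definition switch a b (p : {set {set 'I_n}} * 'I_n) :=
  (p.1 :\ [set a; b]) :|: [set [set p.2; b]].

Lemma switch_notin T a b z : is_spanning_tree T -> [set a; b] \in T ->
  connect (adj (T :\ [set a; b])) a z -> [set z; b] \notin T :\ [set a; b].
Proof.
move=> Ts abT az; apply: contra (tree_del_edge Ts abT) => zb.
exact: connect_trans az (connect1 zb).
Qed.

Lemma switch_tree T a b z : is_spanning_tree T -> [set a; b] \in T ->
  connect (adj (T :\ [set a; b])) a z -> is_spanning_tree (switch a b (T, z)).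
Proof.
move=> Ts abT az; have [Te Tc Tn] := spanning_treeP _ Ts.
have zb : z != b by apply/negP => /eqP zb; move: (tree_del_edge Ts abT); rewrite -{2}zb az.
have cb x : connect (adj (switch a b (T, z))) b x.
  have sG : T :\ [set a; b] \subset switch a b (T, z) by apply: subsetUl.
  have /orP[ax|bx] := tree_del_cover a b x Ts; last exact: connect_adjS bx.
  have bz : connect (adj (switch a b (T, z))) b z.
    by apply: connect1; rewrite /adj /switch !inE /= setUC eqxx orbT.
  apply: connect_trans bz _; apply: connect_trans (connect_adjS sG ax).
  by rewrite connect_adjC; apply: connect_adjS az.
apply/spanning_treeP; split.
- move=> e; rewrite !inE /= => /orP[/andP[_ /Te]//|/eqP ->].
  by rewrite /is_edge cards2 zb.
- by move=> x y; apply: connect_trans (cb y); rewrite connect_adjC.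
- rewrite /switch setUC cardsU1 switch_notin //= -Tn.
  by rewrite [RHS](cardsD1 [set a; b]) abT.
Qed.

(** The switched tree reveals [z] as the last vertex before [b] on its path from [a] to [b].
    Replacing [zb] by [ab] then gives back the original tree. *)
Lemma switch_inj a b :
  {in [pred p | [&& is_spanning_tree p.1, [set a; b] \in p.1 &
        connect (adj (p.1 :\ [set a; b])) a p.2]] &, injective (switch a b)}.
Proof.
move=> [T1 z1] [T2 z2] /and3P[/= T1s ab1 az1] /and3P[/= T2s ab2 az2] E.
have del T z : is_spanning_tree T -> [set a; b] \in T ->
    connect (adj (T :\ [set a; b])) a z ->
    switch a b (T, z) :\ [set z; b] = T :\ [set a; b].
  move=> Ts abT az; rewrite /switch /= setUC setU1K //.
  exact: switch_notin.
have := switch_tree T1s ab1 az1; set T' := switch a b (T1, z1) in E * => T's.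
have D1 : T' :\ [set z1; b] = T1 :\ [set a; b] by apply: del.
have D2 : T' :\ [set z2; b] = T2 :\ [set a; b] by rewrite E; apply: del.
have in1 : [set z1; b] \in T' by rewrite /T' !inE eqxx orbT.
have in2 : [set z2; b] \in T' by rewrite E !inE eqxx orbT.
have z12 : z1 = z2.
  apply/eqP/negPn/negP => z12.
  have e12 : [set z1; b] != [set z2; b].
    by apply: contraNneq z12 => /set2_inj[[-> _]|[-> ->]].
  have n1 := tree_del_edge T's in1; have n2 := tree_del_edge T's in2.
  rewrite -D1 in az1; rewrite -D2 in az2.
  set T'' := (T' :\ [set z2; b]) :\ [set z1; b].
  have s2 : T'' \subset T' :\ [set z2; b] by apply: subD1set.
  have s1 : T'' \subset T' :\ [set z1; b] by rewrite /T'' setDDl setUC -setDDl subD1set.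
  have contra1 : ~ connect (adj (T' :\ [set z1; b])) a b.
    move=> cab; move/negP: n1; apply.
    by apply: connect_trans cab; rewrite connect_adjC.
  case: (connect_del_edge z1 b az2) => [c|[_ c]|[c _]].
  - apply: contra1; apply: connect_trans (connect_adjS s1 c) _.
    by apply: connect1; rewrite /adj in_setD1 eq_sym e12.
  - by move/negP: n2; apply; rewrite connect_adjC; apply: connect_adjS c.
  - exact: contra1 (connect_adjS s1 c).
subst z2; congr (_, _).
by rewrite -(setD1K ab1) -(setD1K ab2) -D1 -D2.
Qed.

(** The switching injects the counted pairs into the trees containing [E], because the only deleted
    edge [ab] is not in [E]. *)
Lemma switch_card_half E a b : [set a; b] \notin E ->
  \sum_(T | [&& is_spanning_tree T, [set a; b] \in T & E \subset T])
     #|[set z | connect (adj (T :\ [set a; b])) a z]|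
  <= #|[set T | is_spanning_tree T && (E \subset T)]|.
Proof.
move=> abE.
pose D := [set p : {set {set 'I_n}} * 'I_n |
   [&& is_spanning_tree p.1, [set a; b] \in p.1, E \subset p.1 &
        connect (adj (p.1 :\ [set a; b])) a p.2]].
have -> : \sum_(T | [&& is_spanning_tree T, [set a; b] \in T & E \subset T])
     #|[set z | connect (adj (T :\ [set a; b])) a z]| = #|D|.
  rewrite -sum1_card; under eq_bigr do rewrite -sum1_card.
  rewrite pair_big_dep /=; apply: eq_bigl => p; rewrite !inE /=.
  by rewrite -!andbA.
have injD : {in D &, injective (switch a b)}.
  move=> p1 p2 p1D p2D; apply: switch_inj; rewrite !inE.
    by move: p1D; rewrite inE => /and4P[-> -> _ ->].
  by move: p2D; rewrite inE => /and4P[-> -> _ ->].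
rewrite -(card_in_imset injD); apply: subset_leq_card.
apply/subsetP => p' /imsetP[[T z]]; rewrite inE /= => /and4P[Ts abT ET az] ->.
rewrite inE switch_tree //=; apply/subsetP => e eE.
rewrite !inE (subsetP ET _ eE) andbT; apply/orP; left.
by apply: contraNneq abE => <-.
Qed.

(** Without [ab] every vertex is on the side of [a] or of [b], so moving either end of [ab] gives at
    least [n] switchings per tree in total. *)
Lemma edge_negative_correlation E a b : [set a; b] \notin E ->
  n * #|[set T | [&& is_spanning_tree T, [set a; b] \in T & E \subset T]]|
  <= 2 * #|[set T | is_spanning_tree T && (E \subset T)]|.
Proof.
move=> abE; rewrite mul2n -addnn.
have baE : [set b; a] \notin E by rewrite setUC.
apply: leq_trans (leq_add (switch_card_half abE) (switch_card_half baE)).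
rewrite setUC -big_split /= mulnC -sum_nat_cond_const /=.
apply: leq_sum => T /and3P[Ts _ _].
rewrite -cardsUI -[X in X <= _](card_ord n) -cardsT; apply: leq_trans (leq_addr _ _).
apply: subset_leq_card; apply/subsetP => z _; rewrite !inE.
by rewrite orbC; apply: tree_del_cover.
Qed.

End Trees.

(** * Moments of the number of tree edges in a given edge set *)

Section TreeMoments.
Variable n : nat.
Implicit Types (T X : {set {set 'I_n}}) (e f : {set 'I_n}).

Let ntrees := #|[set T | @is_spanning_tree n T]|.
Let ntrees_with e := #|[set T | is_spanning_tree T && (e \in T)]|.

Lemma card_edges : #|[set e : {set 'I_n} | is_edge e]| = 'C(n, 2).
Proof.
by rewrite -[in RHS](card_ord n) -card_draws.
Qed.

Lemma tree_edge_card_le e : is_edge e -> n * ntrees_with e <= 2 * ntrees.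
Proof.
move=> /cards2P[a [b [_ ->]]].
have := @edge_negative_correlation n finset.set0 a b; rewrite inE => /(_ isT).
rewrite /ntrees_with /ntrees.
under eq_finset do rewrite finset.sub0set andbT.
by under [in X in _ <= X -> _]eq_finset do rewrite finset.sub0set andbT.
Qed.

Lemma sum_tree_edges :
  \sum_(e | is_edge e) ntrees_with e = ntrees * n.-1.
Proof.
rewrite /ntrees_with; under eq_bigr do rewrite -sum1dep_card big_mkcondr.
rewrite exchange_big /= /ntrees -sum1dep_card big_distrl /=.
apply: eq_bigr => T /spanning_treeP[Te _ <-].
rewrite mul1n -sum1_card -big_mkcondr /=; apply: eq_bigl => e.
by case: (boolP (e \in T)) => [/Te ->|]; rewrite ?andbF.
Qed.

(* Every edge lies in at most a fraction 2/n of the trees, and these fractions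
   average to exactly 2/n because each tree has n - 1 edges. *)
Lemma tree_edge_card e : is_edge e -> n * ntrees_with e = 2 * ntrees.
Proof.
move=> ee; apply/eqP; rewrite eqn_leq tree_edge_card_le //=.
have sumE : \sum_(f | is_edge f) n * ntrees_with f = 'C(n, 2) * (2 * ntrees).
  rewrite -big_distrr /= sum_tree_edges.
  have := mul_bin_diag n 1; rewrite bin1 => nE.
  by rewrite mulnCA nE; lia.
have : \sum_(f | is_edge f && (f != e)) n * ntrees_with f
       <= ('C(n, 2)).-1 * (2 * ntrees).
  apply: (@leq_trans (\sum_(f | is_edge f && (f != e)) 2 * ntrees)).
    by apply: leq_sum => f /andP[fe _]; apply: tree_edge_card_le.
  rewrite sum_nat_cond_const leq_mul2r; apply/orP; right.
  rewrite -card_edges [X in _ <= X.-1](cardsD1 e) inE ee /=.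
  by apply/eq_leq/eq_card => f; rewrite !inE andbC.
move: sumE; rewrite (bigD1 e) //=.
have : 0 < 'C(n, 2) by rewrite -card_edges; apply/card_gt0P; exists e; rewrite inE.
case: 'C(n, 2) => // m _; rewrite mulSn /= => H1 H2.
by rewrite -(leq_add2r (m * (2 * ntrees))) -H1 leq_add2l.
Qed.

(** By negative correlation at most a fraction [2/n] of the trees through [f] contain [e], and the
    trees through [f] are a fraction [2/n] of all. *)
Lemma tree_edge_pair_card e f : is_edge e -> is_edge f -> e != f ->
  n ^ 2 * #|[set T | [&& is_spanning_tree T, e \in T & f \in T]]|
  <= 4 * ntrees.
Proof.
move=> /cards2P[a [b [_ ->]]] fe; set ab := [set a; b] => abf.
have := @edge_negative_correlation n [set f] a b; rewrite inE => /(_ abf).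
under eq_finset do rewrite finset.sub1set.
under [in X in _ <= X -> _]eq_finset do rewrite finset.sub1set.
have := tree_edge_card_le fe; rewrite /ntrees_with => H1 H2.
rewrite expnS expn1 -mulnA; apply: leq_trans (leq_mul (leqnn n) H2) _.
by rewrite mulnCA -[4]/(2 * 2) -[2 * 2 * _]mulnA leq_mul2l /=.
Qed.

Lemma tree_meet_sum1 X : {in X, forall e, is_edge e} ->
  n * \sum_(T | is_spanning_tree T) #|T :&: X| = 2 * #|X| * ntrees.
Proof.
move=> Xe.
have -> : \sum_(T | is_spanning_tree T) #|T :&: X| = \sum_(e in X) ntrees_with e.
  rewrite /ntrees_with; under [RHS]eq_bigr do rewrite -sum1dep_card big_mkcondr.
  rewrite exchange_big /=; apply: eq_bigr => T _.
  rewrite -sum1_card -big_mkcondr /=; apply: eq_bigl => e.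
  by rewrite inE andbC.
rewrite big_distrr /= (eq_bigr (fun=> 2 * ntrees)).
  by rewrite sum_nat_const mulnA [#|X| * 2]mulnC.
by move=> e eX; apply: tree_edge_card; apply: Xe.
Qed.

(** The square counts ordered pairs of edges: the diagonal gives the first moment, and any other
    pair lies in at most a fraction [4/n^2] of the trees. *)
Lemma tree_meet_sum2 X : {in X, forall e, is_edge e} ->
  n ^ 2 * \sum_(T | is_spanning_tree T) #|T :&: X| ^ 2
  <= n * (2 * #|X| * ntrees) + 4 * #|X| ^ 2 * ntrees.
Proof.
move=> Xe.
have -> : \sum_(T | is_spanning_tree T) #|T :&: X| ^ 2 =
    \sum_(e in X) \sum_(f in X)
       #|[set T | [&& is_spanning_tree T, e \in T & f \in T]]|.
  under [RHS]eq_bigr do under eq_bigr do rewrite -sum1dep_card big_mkcondr.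
  under [RHS]eq_bigr do rewrite exchange_big.
  rewrite exchange_big /=; apply: eq_bigr => T _.
  rewrite expnS expn1 -{1}sum1_card big_distrl /=.
  rewrite [LHS](eq_bigl (fun e => (e \in X) && (e \in T))); last first.
    by move=> e; rewrite inE andbC.
  rewrite big_mkcondr /=; apply: eq_bigr => e eX; case: (e \in T); last first.
    by rewrite big1.
  rewrite mul1n -sum1_card -big_mkcondr /=; apply: eq_bigl => f.
  by rewrite inE andbC.
have -> : n * (2 * #|X| * ntrees) + 4 * #|X| ^ 2 * ntrees =
    \sum_(e in X) (n * (2 * ntrees) + #|X| * (4 * ntrees)).
  by rewrite sum_nat_const expnS expn1; ring.
rewrite big_distrr /=; apply: leq_sum => e eX; have ee := Xe _ eX.
rewrite (bigD1 e) //= mulnDr leq_add //.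
  rewrite expnS expn1 -mulnA -(tree_edge_card ee) leq_mul2l leq_mul2l.
  apply/orP; right; apply/orP; right; apply/eq_leq/eq_card => T.
  by rewrite !inE andbb.
rewrite big_distrr /= -sum_nat_const [X in _ <= X](bigD1 e) //=.
apply: leq_trans (leq_addl _ _); apply: leq_sum => f /andP[fX fe].
by apply: tree_edge_pair_card; rewrite // 1?eq_sym //; apply: Xe.
Qed.

(* Second moment method for the number N of edges of X in a uniform tree, whose
   mean is mu := 2|X|/n: negative correlation gives E(N - 1 - mu)^2 <= 1 + mu, and
   N = 0 contributes (1 + mu)^2. *)
Lemma tree_miss_card X : {in X, forall e, is_edge e} ->
  2 * #|X| * #|[set T | is_spanning_tree T && (T :&: X == finset.set0)]|
  <= n * #|[set T | is_spanning_tree T && (T :&: X != finset.set0)]|.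
Proof.
move=> Xe.
have S1 := tree_meet_sum1 Xe; have S2 := tree_meet_sum2 Xe.
set Z := #|[set T | _ && (_ == _)]|; set Y := #|[set T | _ && (_ != _)]|.
have aE : ntrees = Z + Y.
  rewrite /ntrees -(cardsID [set T | T :&: X == finset.set0]).
  by congr (_ + _); apply: eq_card => T; rewrite !inE // andbC.
pose s1 := \sum_(T | is_spanning_tree T) #|T :&: X|.
pose s2 := \sum_(T | is_spanning_tree T) #|T :&: X| ^ 2.
pose m := n + 2 * #|X|.
(* Here [m] is [n (1 + mu)]. Each tree is treated by [2xy <= x^2 + y^2] with [x = n #|T :&: X|] and
   [y = m]; a tree missing [X] has [x = 0], which leaves room for the extra [m^2]. *)
have H : m ^ 2 * Z + 2 * m * n * s1 <= n ^ 2 * s2 + m ^ 2 * ntrees.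
  have -> :
      m ^ 2 * Z = \sum_(T | is_spanning_tree T) m ^ 2 * (T :&: X == finset.set0).
    rewrite -big_distrr /= /Z -sum1dep_card big_mkcondr; congr (_ * _).
  have nE : m ^ 2 * ntrees = \sum_(T : {set {set 'I_n}} | is_spanning_tree T) m ^ 2.
    by rewrite /ntrees -sum1dep_card big_distrr /=; apply: eq_bigr => *; rewrite muln1.
  rewrite nE /s1 /s2 !big_distrr -!big_split /=; apply: leq_sum => T _.
  have [->|_] := eqVneq; first by rewrite cards0 !muln0 addn0 muln1.
  rewrite muln0 add0n -expnMn -[2 * m * n * _]mulnA -[2 * m * _]mulnA [m * _]mulnC.
  by have [] := nat_Cauchy (n * #|T :&: X|) m.
rewrite -/s1 -/s2 -/ntrees -/m in S1 S2 *.
have [m0|m_gt0] := posnP m; first by move: m0; rewrite /m; lia.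
have : m * (m * Z) <= m * (n * ntrees).
  have : m * (m * Z) + 2 * m * (2 * #|X| * ntrees) <=
     n * (2 * #|X| * ntrees) + 4 * #|X| ^ 2 * ntrees + m ^ 2 * ntrees.
    rewrite -[X in _ + X]mulnA -S1 mulnA in H *.
    have -> : m * (m * Z) = m ^ 2 * Z by ring.
    by rewrite (leq_trans H) // leq_add2r S1.
  by rewrite /m; clear; move: #|X| ntrees Z => x a z H; nia.
by rewrite leq_pmul2l // aE /m; clear; nia.
Qed.

End TreeMoments.
(** * The adversarial game and the greedy strategy *)

Lemma card_stree n (P : pred {set {set 'I_n}}) :
  #|[set T : stree n | P (val T)]| = #|[set T | is_spanning_tree T && P T]|.
Proof.
rewrite -(card_imset _ val_inj); apply: eq_card => T; rewrite !inE.
apply/imsetP/andP => [[T'] + ->|[Ts PT]].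
  by rewrite inE; split=> //; apply: valP.
by exists (Sub T Ts); rewrite ?inE SubK.
Qed.

Section Game.
Variables (R : realFieldType) (n : nat).
Implicit Types (F G T : {set {set 'I_n}}) (e : {set 'I_n}).
Implicit Types (goal : {set {set 'I_n}} -> bool) (cs : seq R) (c : R).
Local Open Scope ring_scope.

(* A game against an adversary: in each round Builder either passes or offers a
   set of at least 1/c edges, of which the adversary has one added to F. *)
Fixpoint reach goal cs F : bool :=
  if cs is c :: cs' then
    reach goal cs' F ||
    (1 <= c * #|[set e | is_edge e & reach goal cs' (F :|: [set e])]|%:R)
  else goal F.

Definition increasing goal := forall F G, F \subset G -> goal F -> goal G.

Lemma reach_increasing goal cs : all (fun c => 0 <= c) cs ->
  increasing goal -> increasing (reach goal cs).
Proof.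
move=> + gi; elim: cs => [_|c cs IH /= /andP[c0 /IH{}IH]] F G FG //=; first exact: gi.
case/orP => [/(IH _ _ FG)->//|H]; apply/orP; right; apply: (le_trans H).
rewrite ler_wpM2l // ler_nat subset_leq_card //; apply/subsetP => e.
rewrite !inE => /andP[-> ] /=; apply: IH; exact: finset.setSU.
Qed.

Lemma reach_impl goal1 goal2 cs F : all (fun c => 0 <= c) cs ->
  (forall G, goal1 G -> goal2 G) -> reach goal1 cs F -> reach goal2 cs F.
Proof.
move=> + g12; elim: cs F => [F _|c cs IH F /= /andP[c0 csp]] /=; first exact: g12.
case/orP => [/(IH _ csp)->//|H]; apply/orP; right; apply: (le_trans H).
rewrite ler_wpM2l // ler_nat subset_leq_card //; apply/subsetP => e.
rewrite !inE => /andP[-> ]; exact: IH.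
Qed.

(** Edges are never removed. This lets a later phase of the game use what an earlier one has
    built. *)
Lemma reach_ge goal cs F0 F : all (fun c => 0 <= c) cs -> F0 \subset F ->
  reach goal cs F -> reach (fun G => goal G && (F0 \subset G)) cs F.
Proof.
elim: cs F => [F _ F0F gF|c cs IH F /= /andP[c0 csp] F0F] /=; first exact/andP.
case/orP => [/(IH _ csp F0F)->//|H]; apply/orP; right; apply: (le_trans H).
rewrite ler_wpM2l // ler_nat subset_leq_card //; apply/subsetP => e.
rewrite !inE => /andP[-> ] /=; apply: IH => //.
exact: fintype.subset_trans F0F (subsetUl _ _).
Qed.

Lemma reach_done goal cs F : goal F -> reach goal cs F.
Proof. by elim: cs => //= c cs IH /IH ->. Qed.

Lemma reach_cat goal cs1 cs2 F :
  reach goal (cs1 ++ cs2) F = reach (reach goal cs2) cs1 F.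
Proof.
elim: cs1 F => //= c cs IH F; rewrite IH; congr (_ || (_ <= _ * _%:R)).
by apply: eq_card => e; rewrite !inE IH.
Qed.

Lemma reach_suffix goal cs1 cs2 F : suffix cs1 cs2 ->
  reach goal cs1 F -> reach goal cs2 F.
Proof. by move=> /suffixP[cs ->] H; rewrite reach_cat; apply: reach_done. Qed.

(** Builder offers every edge that lowers the potential [Psi], with [P] as invariant. The costs run
    from high to low potential, and after a drop by more than one he passes. *)
Lemma reach_potential goal (P : {set {set 'I_n}} -> Prop)
    (Psi : {set {set 'I_n}} -> nat) (c : nat -> R) (m : nat) F :
  (forall j G, P G -> Psi G = j.+1 ->
     1 <= c j * #|[set e | is_edge e & Psi (G :|: [set e]) <= j]|%N%:R) ->
  (forall j, 0 <= c j) ->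
  (forall G e, P G -> P (G :|: [set e])) ->
  (forall G, P G -> Psi G = 0%N -> goal G) ->
  P F -> (Psi F <= m)%N -> reach goal [seq c i | i <- rev (iota 0 m)] F.
Proof.
move=> Hc c0 HP Hg; elim: m F => [|m IH] F PF.
  by rewrite leqn0 => /eqP; exact: Hg.
rewrite -addn1 iotaD rev_cat /= add0n leq_eqVlt => /orP[/eqP E|].
  apply/orP; right; rewrite addn1 in E; apply: le_trans (Hc _ _ PF E) _.
  rewrite ler_wpM2l // ler_nat subset_leq_card //; apply/subsetP => e.
  rewrite !inE => /andP[-> ] /=; apply: IH; exact: HP.
by rewrite addn1 ltnS => /(IH _ PF) ->.
Qed.

(** From a winning position this is the shortest suffix of the costs that still wins. Being computed
    from [F] alone, it tells the strategy how far the game has advanced without any memory of past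
    rounds. *)
Fixpoint stage goal cs F : seq R :=
  if cs is c :: cs' then
    if reach goal cs' F then stage goal cs' F else cs
  else [::].

Lemma stage_is_suffix goal cs F : suffix (stage goal cs F) cs.
Proof.
elim: cs => //= c cs IH; case: ifP => _; last exact: suffix_refl.
apply: (suffix_trans IH); exact: (suffix_suffix [:: c]).
Qed.

Lemma stage_suffix goal cs cs' F :
  suffix cs' cs -> reach goal cs' F -> suffix (stage goal cs F) cs'.
Proof.
elim: cs cs' => [|c cs IH] cs' /=.
  by rewrite suffixs0 => /eqP ->; rewrite suffixs0.
move=> s H; have : (cs' == c :: cs) || suffix cs' cs.
  case/suffixP: s => -[|c0 s] /= E; first by rewrite -E eqxx.
  by case: E => _ ->; rewrite suffix_suffix orbT.
case/orP => [/eqP ->|s'].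
  exact: (stage_is_suffix _ (c :: cs)).
by rewrite (reach_suffix s' H) IH.
Qed.

Lemma stage_reach goal cs F : reach goal cs F -> reach goal (stage goal cs F) F.
Proof. by elim: cs => //= c cs IH; case: ifP => [/IH//|H] /=; rewrite H. Qed.

Lemma stage_cons goal cs F c cs' :
  stage goal cs F = c :: cs' -> ~~ reach goal cs' F.
Proof.
by elim: cs => //= c0 cs IH; case: ifP => [_ /IH//|H [_ <-]]; rewrite H.
Qed.

(** A good edge wins with the first remaining cost spent. Failing that, any edge of [T] is taken;
    the default empty set occurs only when [T] is empty. *)
Definition greedy goal cs : strategy n := fun F T =>
  let good e := reach goal (behead (stage goal cs F)) (F :|: [set e]) in
  odflt (odflt finset.set0 [pick e in T]) [pick e in T | good e].

Lemma greedy_valid goal cs : (2 <= n)%N -> valid_strategy (greedy goal cs).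
Proof.
move=> n2 F T /spanning_treeP[_ _ Tn]; rewrite /greedy.
case: pickP => [e eT|T0]; first by case: pickP => [e' /andP[]//|].
have : (0 < #|T|)%N by rewrite Tn; case: (n) n2 => [|[]].
by case/card_gt0P => e; rewrite T0.
Qed.

Lemma greedy_good goal cs F T e : e \in T ->
  reach goal (behead (stage goal cs F)) (F :|: [set e]) ->
  reach goal (behead (stage goal cs F)) (F :|: [set greedy goal cs F T]).
Proof.
move=> eT He; rewrite /greedy.
by case: (pickP (fun e => (e \in T) && _)) => [e' /andP[]//|/(_ e)]; rewrite eT He.
Qed.

(** * Random play of a strategy and its failures *)

Definition builder_step (sigma : strategy n) F T := F :|: [set sigma F T].

(** For an increasing goal the final graph decides whether the goal was ever met, so this counts the
    outcomes that fail within [t] rounds. *)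
Definition missed goal (sigma : strategy n) t F :=
  #|[set w : t.-tuple (stree n) |
      ~~ goal (foldl (builder_step sigma) F (map val w))]|.

Lemma missedS goal sigma t F :
  missed goal sigma t.+1 F =
  (\sum_(T : stree n) missed goal sigma t (builder_step sigma F (val T)))%N.
Proof.
rewrite /missed; under eq_bigr do rewrite -sum1dep_card.
rewrite pair_big_dep /= -sum1dep_card.
rewrite (reindex (fun p : stree n * t.-tuple (stree n) => [tuple of p.1 :: p.2])) //=.
exists (fun w => (thead w, [tuple of behead w])) => [[T w] _|w _] /=.
  by congr (_, _); apply/val_inj.
by rewrite [RHS]tuple_eta.
Qed.

Lemma missed_le goal sigma t F : (missed goal sigma t F <= #|{: stree n}| ^ t)%N.
Proof. by rewrite -card_tuple; apply: max_card. Qed.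

Lemma missed_done goal sigma t F : increasing goal -> goal F ->
  missed goal sigma t F = 0%N.
Proof.
move=> gi gF; apply/eqP; rewrite cards_eq0; apply/eqP/setP => w.
rewrite !inE; apply/negbTE; rewrite negbK.
elim: (map val w) F gF => //= T s IH F gF; apply: IH.
by apply: gi gF; apply: subsetUl.
Qed.

(* Rounds are split into those that shorten the list of remaining costs, at most
   size cs of them, and misses; the expected number of misses at a cost c is at
   most c * n / 2, and the bound below is Markov's inequality run through time. *)
Lemma missed_bound goal cs M t F :
  all (fun c => 0 <= c) cs -> increasing goal -> reach goal cs F ->
  M%:R * (missed goal (greedy goal cs) t F)%:R <=
  #|{: stree n}|%:R ^+ t *
  (n%:R / 2 * (\sum_(c <- stage goal cs F) c)
    + (size (stage goal cs F) + M - t)%N%:R).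
Proof.
(* [B] does not grow on average. Its first term bounds the expected future misses; the second, a
   truncated difference, is the shortage of rounds for all remaining costs and [M] misses. *)
move=> cs0 gi; set a := #|{: stree n}|; pose B t F := n%:R / 2 * (\sum_(c <- stage goal cs F) c)
    + (size (stage goal cs F) + M - t)%N%:R : R.
rewrite -/(B t F).
have suf0 cs' : suffix cs' cs -> all (fun c => 0 <= c) cs'.
  by move=> /suffixP[s E]; move: cs0; rewrite E all_cat => /andP[].
have sum0 cs' : suffix cs' cs -> 0 <= \sum_(c <- cs') c.
  by move=> /suf0 /allP H; rewrite big_seq sumr_ge0.
have B0 u G : 0 <= B u G.
  rewrite addr_ge0 // mulr_ge0 ?divr_ge0 ?ler0n //; apply: sum0.
  exact: stage_is_suffix.
have Ble cs' u G : suffix cs' cs -> reach goal cs' G ->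
    B u G <= n%:R / 2 * (\sum_(c <- cs') c) + (size cs' + M - u)%N%:R.
  move=> s H; have /suffixP[p E] := stage_suffix s H.
  rewrite E big_cat /= mulrDr; apply: lerD; last first.
    by rewrite ler_nat; rewrite size_cat; lia.
  rewrite lerDr mulr_ge0 ?divr_ge0 //.
  have := suf0 _ s; rewrite E all_cat => /andP[/allP H' _].
  by rewrite big_seq sumr_ge0.
elim: t F => [|t IH] F HF.
  rewrite expr0 mul1r.
  case E : (stage goal cs F) => [|c cs'].
    have gF : goal F by have := stage_reach HF; rewrite E.
    by rewrite missed_done // mulr0.
  (* With no round left and the goal not met, the shortage alone is at least [M]. *)
  apply: (@le_trans _ _ (M%:R)).
    rewrite -[X in _ <= X]mulr1 ler_wpM2l // -[1](_ : 1%:R = 1) // ler_nat.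
    by apply: leq_trans (missed_le _ _ _ _) _; rewrite expn0.
  apply: (@le_trans _ _ ((size (stage goal cs F) + M - 0)%N%:R)).
    by rewrite ler_nat subn0 leq_addl.
  rewrite lerDr mulr_ge0 ?divr_ge0 //; apply: sum0; exact: stage_is_suffix.
have [gF|gF] := boolP (goal F); first by rewrite missed_done // mulr0 mulr_ge0 // exprn_ge0.
rewrite missedS natr_sum mulr_sumr exprS -mulrA.
have [c [cs' E]] : exists c cs', stage goal cs F = c :: cs'.
  case E : (stage goal cs F) => [|c cs']; last by exists c, cs'.
  by move: gF; have := stage_reach HF; rewrite E /= => ->.
have scs' : suffix cs' cs.
  apply: (@suffix_trans _ (c :: cs')); first exact: (suffix_suffix [:: c]).
  by rewrite -E stage_is_suffix.
have c0 : 0 <= c.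
  by have := suf0 _ (stage_is_suffix goal cs F); rewrite E => /andP[].
pose X := [set e | is_edge e & reach goal cs' (F :|: [set e])].
have HX : 1 <= c * #|X|%:R.
  have := stage_reach HF; rewrite E /= => /orP[H|//].
  by have := stage_cons E; rewrite H.
pose b0 := n%:R / 2 * (\sum_(c <- cs') c) + (size cs' + M - t)%N%:R : R.
pose hit (T : stree n) := val T :&: X != finset.set0.
have Hhit (T : stree n) : hit T -> B t (builder_step (greedy goal cs) F (val T)) <= b0.
  move=> /set0Pn[e]; rewrite !inE => /and3P[eT _ He].
  apply: Ble => //; have := @greedy_good goal cs F (val T) e eT.
  by rewrite E; apply.
have BtF : B t.+1 F = n%:R / 2 * c + b0.
  rewrite /B E big_cons mulrDr /b0 -addrA; congr (_ + (_ + _%:R)).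
have Hmiss (T : stree n) : B t (builder_step (greedy goal cs) F (val T)) <= n%:R / 2 * c + b0 + 1.
  apply: (le_trans (Ble (c :: cs') _ _ _ _)).
  - by rewrite -E stage_is_suffix.
  - apply: (reach_increasing _ gi (subsetUl F _)); last by rewrite -E stage_reach.
    by apply: suf0; rewrite -E stage_is_suffix.
  - rewrite big_cons mulrDr /b0 -!addrA lerD2l lerD2l natr1 ler_nat /=.
    by move: (size cs') => s; clear; lia.
have Hr (T : stree n) : reach goal cs (builder_step (greedy goal cs) F (val T)).
  by apply: (reach_increasing cs0 gi (subsetUl F _) HF).
apply: (@le_trans _ _ (\sum_(T : stree n) a%:R ^+ t *
    B t (builder_step (greedy goal cs) F (val T)))).
  by apply: ler_sum => T _; apply: IH.
rewrite -mulr_sumr mulrCA ler_wpM2l ?exprn_ge0 //.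
apply: (@le_trans _ _ (\sum_(T : stree n) (b0 + (~~ hit T)%:R * (n%:R / 2 * c + 1)))).
  apply: ler_sum => T _; have [hT|mT] := boolP (hit T).
    by rewrite mul0r addr0 Hhit.
  by rewrite mul1r addrCA addrA Hmiss.
have Z := card_stree (fun T => T :&: X == finset.set0).
have Y := card_stree (fun T => T :&: X != finset.set0).
have Xe : {in X, forall e, is_edge e} by move=> e; rewrite inE => /andP[].
have := tree_miss_card Xe; rewrite -Z -Y.
set z := (X in (2 * _ * X <= _)%N); set y := (X in (_ <= _ * X)%N) => zy.
have ayz : a = (z + y)%N.
  rewrite /a -cardsT -(cardsID [set T : stree n | val T :&: X == finset.set0]).
  by congr (_ + _)%N; apply: eq_card => T; rewrite !inE /= ?andbT.
have zE : \sum_(T : stree n) (~~ hit T)%:R = z%:R :> R.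
  rewrite -natr_sum; congr _%:R; rewrite /z -sum1dep_card [RHS]big_mkcond /=.
  by apply: eq_bigr => T _; rewrite /hit negbK; case: (_ == _).
rewrite big_split /= sumr_const -/a -mulr_suml zE BtF -[b0 *+ _]mulr_natl -/a.
have zyR : 2 * #|X|%:R * z%:R <= n%:R * y%:R :> R.
  by rewrite -!natrM ler_nat.
(* A hit lowers [B] by at least [n c / 2] and a miss raises it by at most 1, so this ratio of misses
   to hits is exactly what is needed. *)
have : z%:R <= n%:R / 2 * c * y%:R.
  apply: (@le_trans _ _ (c * #|X|%:R * z%:R)).
    by rewrite -[X in X <= _]mul1r ler_wpM2r.
  have := ler_wpM2l c0 zyR; lra.
rewrite ayz natrD; lra.
Qed.

End Game.
(** * Trees of cliques *)

Section Cores.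
Variables (R : realFieldType) (n N : nat).
Implicit Types (F G : {set {set 'I_n}}) (p q : seq 'I_n) (x y v s : 'I_n).

(** The inequality keeps a singleton in [F] from acting as a loop, so that pairwise adjacent lists
    have no repetition. *)
Definition nbr F : rel 'I_n := fun x y => (x != y) && ([set x; y] \in F).

Lemma nbr_sym F : symmetric (nbr F).
Proof. by move=> x y; rewrite /nbr eq_sym setUC. Qed.

Lemma nbrS F G x y : F \subset G -> nbr F x y -> nbr G x y.
Proof. by move=> /subsetP FG /andP[xy /FG]; rewrite /nbr xy. Qed.

(* The clique p extends to a tree of cliques of height j in which every node has
   at least N children. *)
Fixpoint extendable F j p : bool :=
  if j is j'.+1 then N <= #|[set s | extendable F j' (s :: p)]|
  else pairwise (nbr F) p.

Lemma extendableS F G j p : F \subset G -> extendable F j p -> extendable G j p.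
Proof.
move=> FG; elim: j p => [|j IH] p /=.
  by apply: sub_pairwise => x y; apply: nbrS.
move=> H; apply: (leq_trans H); apply: subset_leq_card; apply/subsetP => s.
by rewrite !inE; apply: IH.
Qed.

(** Every node has a child other than [v], so some branch can be followed to its end without meeting
    [v]. *)
Lemma extendable_avoid F j p v : 2 <= N -> extendable F j p -> v \notin p ->
  exists q, [/\ size q = j, pairwise (nbr F) (q ++ p) & v \notin q].
Proof.
move=> N2; elim: j p => [|j IH] p /=; first by exists [::].
move=> Np vp; set S := [set s | _] in Np.
have /card_gt0P[s] : 0 < #|S :\ v|.
  by move: Np; rewrite (cardsD1 v S); move: (_ \in S) => b; lia.
rewrite !inE => /andP[sv sE].
have [|q [sq cq vq]] := IH _ sE; first by rewrite inE negb_or eq_sym sv.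
exists (rcons q s); split; first by rewrite size_rcons sq.
  by rewrite cat_rcons.
by rewrite mem_rcons inE negb_or eq_sym sv.
Qed.

(** Inside a set of [N ^ (c (j + 1))] vertices, at least a fraction [1/N] of them can serve as the
    next leaf. *)
Definition star_cost (c j : nat) : R := (N%:R / (N ^ (c * j.+1))%:R)%R.

(** For each of the [N] children: first a star whose leaves are the candidates for all later levels,
    then the subtree below the child. *)
Fixpoint core_costs c j : seq R :=
  if j is j'.+1 then
    flatten (nseq N (nseq (N ^ (c * j')) (star_cost c j') ++ core_costs c j'))
  else [::].

Lemma star_cost_ge0 c j : (0 <= star_cost c j)%R.
Proof. by rewrite /star_cost divr_ge0. Qed.

Lemma core_costs_ge0 c j : all (fun a : R => 0 <= a)%R (core_costs c j).
Proof.
elim: j => //= j IH; elim: {1}N => //= m IHm; rewrite !all_cat IH IHm !andbT.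
by rewrite all_nseq star_cost_ge0 orbT.
Qed.

(** A star costs [N / N ^ c] in total at every height, so the sums obey the recursion of multiplying
    by [N] after adding this amount. *)
Lemma core_costs_sum c j : 0 < N ->
  (\sum_(x <- core_costs c j) x <= j%:R * N%:R ^+ j.+1 / N%:R ^+ c)%R.
Proof.
move=> N0; have N0R : (0 < N%:R :> R)%R by rewrite ltr0n.
have N1R : (1 <= N%:R :> R)%R by rewrite ler1n.
elim: j => [|j IH]; first by rewrite big_nil mul0r mul0r.
rewrite /= big_flatten /= big_nseq iter_addr_0 big_cat /= big_nseq iter_addr_0.
have -> : (star_cost c j *+ N ^ (c * j) = N%:R / N%:R ^+ c)%R.
  rewrite -[LHS]mulr_natl /star_cost !natrX mulnS exprD.
  have : (N%:R ^+ c != 0 :> R)%R /\ (N%:R ^+ (c * j) != 0 :> R)%R.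
    by rewrite !expf_neq0 // gt_eqF.
  move: (N%:R ^+ c)%R (N%:R ^+ (c * j))%R => x y [x0 y0].
  by field; rewrite x0.
rewrite -[X in (X <= _)%R]mulr_natl.
apply: (@le_trans _ _ (N%:R * (N%:R / N%:R ^+ c + j%:R * N%:R ^+ j.+1 / N%:R ^+ c))%R).
  by rewrite ler_pM2l // lerD2l.
rewrite -mulrDl mulrA ler_wpM2r ?invr_ge0 ?exprn_ge0 ?ler0n //.
rewrite mulrDr -natr1 mulrDl mul1r addrC mulrCA -exprS lerD2l.
by rewrite -expr2 ler_weXn2l.
Qed.

(** The potential is the number of leaves still missing. *)
Lemma reach_star c j F s (S : {set 'I_n}) :
  2 <= N -> 2 <= c -> N ^ (c * j.+1) <= #|S| -> s \in S ->
  reach (fun G => N ^ (c * j) <= #|[set x in S | nbr G s x]|)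
    (nseq (N ^ (c * j)) (star_cost c j)) F.
Proof.
move=> N2 c2 cardS sS; set m := N ^ (c * j).
pose Psi G := m - #|[set x in S | nbr G s x]|.
have -> : nseq m (star_cost c j) =
    [seq (fun=> star_cost c j) i | i <- rev (iota 0 m)].
  have /all_pred1P -> : all (pred1 (star_cost c j))
      [seq (fun=> star_cost c j) i | i <- rev (iota 0 m)].
    by rewrite all_map; apply/allP => i _ /=.
  by rewrite size_map size_rev size_iota.
apply: (@reach_potential _ _ _ (fun=> True) Psi) => //; last by rewrite /Psi leq_subr.
- move=> i G _ PG.
  pose D := [set x in S | (x != s) && ~~ nbr G s x].
  (* A leaf is missing, so [s] and its present leaves number at most [m] together. *)
  have cD : N ^ (c * j.+1) - m <= #|D|.
    rewrite leq_subLR; apply: leq_trans cardS _.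
    have sub : S \subset [set s] :|: [set x in S | nbr G s x] :|: D.
      apply/subsetP => x xS; rewrite !inE xS /=.
      by case: eqP => //= _; case: (nbr G s x).
    apply: leq_trans (subset_leq_card sub) _; apply: leq_trans (leq_card_setU _ _) _.
    rewrite leq_add2r; apply: leq_trans (leq_card_setU _ _) _.
    by rewrite cards1 add1n -subn_gt0 -/(Psi G) PG.
  have sD : #|D| <= #|[set e | is_edge e & Psi (G :|: [set e]) <= i]|.
    have inj : {in D &, injective (fun x => [set s; x])}.
      by move=> x y _ _ /set2_inj[[_ ->]|[-> ->]].
    rewrite -(card_in_imset inj); apply: subset_leq_card.
    apply/subsetP => e /imsetP[x]; rewrite !inE => /and3P[xS xs nx] ->.
    rewrite /is_edge cards2 [s == x]eq_sym xs /= -ltnS -PG /Psi.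
    apply: ltn_sub2l; first by rewrite -subn_gt0 -/(Psi G) PG.
    apply: proper_card; apply/properP; split.
      apply/subsetP => y; rewrite !inE => /andP[-> ] /=; apply: nbrS.
      exact: subsetUl.
    exists x; first by rewrite !inE xS /nbr [s == x]eq_sym xs /= !inE eqxx orbT.
    by rewrite !inE xS.
  have mM : 0 < m /\ m * N <= N ^ (c * j.+1).
    split; first by rewrite expn_gt0 (ltnW N2).
    by rewrite /m -expnSr leq_exp2l // mulnS; lia.
  have H : N ^ (c * j.+1) <= N * #|[set e | is_edge e & Psi (G :|: [set e]) <= i]|.
    apply: leq_trans (leq_mul (leqnn N) (leq_trans cD sD)); rewrite mulnBr; nia.
  rewrite /star_cost mulrAC ler_pdivlMr ?mul1r -?natrM ?ler_nat //.
  by rewrite ltr0n expn_gt0 (ltnW N2).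
- by move=> i; apply: star_cost_ge0.
- by move=> G _ /eqP; rewrite subn_eq0.
Qed.

(** [S] consists of common neighbours of [p]. A new child [s] is taken from [S], and the leaves of a
    star at [s] within [S] are common neighbours of [s :: p], ready for the induction. *)
Lemma reach_core c j F p (S : {set 'I_n}) : 2 <= N -> 2 <= c ->
  pairwise (nbr F) p -> {in S, forall x, all (nbr F x) p} ->
  N ^ (c * j) <= #|S| ->
  reach (fun G => extendable G j p) (core_costs c j) F.
Proof.
move=> N2 c2; elim: j p S F => [|j IH] p S F cp Sp cardS //=.
pose A G := [set s in S | extendable G j (s :: p)].
(* [m] bounds the number of children still to be completed; containment of graphs keeps the finished
   ones. *)
have loop m G : F \subset G -> N - m <= #|A G| -> m <= N ->
  reach (fun G => N <= #|A G|)
    (flatten (nseq m (nseq (N ^ (c * j)) (star_cost c j) ++ core_costs c j))) G.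
  elim: m G => [|m IHm] G FG AG mN; first by rewrite /= (leq_trans _ AG) ?subn0.
  rewrite /= reach_cat.
  set cs := _ ++ core_costs c j.
  have cs0 : all (fun a : R => 0 <= a)%R cs.
    by rewrite all_cat core_costs_ge0 andbT all_nseq star_cost_ge0 orbT.
  apply: (@reach_impl _ _ (fun H => (N - m <= #|A H|) && (G \subset H))) => //.
    move=> H /andP[AH GH]; apply: IHm => //; last exact: ltnW.
    exact: fintype.subset_trans FG GH.
  apply: reach_ge => //.
  have [AmG|AmG] := leqP (N - m) #|A G|; first exact: reach_done.
  have /card_gt0P[s] : 0 < #|S :\: A G|.
    have AS : A G \subset S by apply/subsetP => x /setIdP[].
    rewrite cardsDS // subn_gt0; apply: leq_trans cardS.
    apply: leq_trans AmG _; apply: leq_trans (leq_subr _ _) _.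
    by rewrite -{1}(expn1 N) leq_exp2l //; nia.
  rewrite !inE => /andP[/negP sA sS].
  rewrite /cs reach_cat.
  apply: (@reach_impl _ _ (fun H => (N ^ (c * j) <= #|[set x in S | nbr H s x]|) && (G \subset H))) => //.
  - by rewrite all_nseq star_cost_ge0 orbT.
  - move=> H /andP[cH GH].
    apply: (@reach_impl _ _ (fun H' => extendable H' j (s :: p) && (H \subset H'))).
    + exact: core_costs_ge0.
    + move=> H' /andP[eH' HH'].
      have GH' : G \subset H' by apply: fintype.subset_trans GH HH'.
      have sub : s |: A G \subset A H'.
        apply/subsetP => x; rewrite !inE => /orP[/eqP ->|/andP[-> /(extendableS GH')->]//].
        by rewrite sS.
      apply: leq_trans (subset_leq_card sub); rewrite cardsU1 !inE sS /=.
      move/negP: sA; rewrite sS /= => ->; rewrite add1n.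
      by rewrite leq_subLR addnS -addSn -leq_subLR.
    + apply: reach_ge => //; first exact: core_costs_ge0.
      have FH : F \subset H by apply: fintype.subset_trans FG GH.
      apply: IH cH => //=.
      * rewrite (sub_pairwise _ cp) ?andbT; last by move=> x y; apply: nbrS.
        by apply: sub_all (Sp _ sS) => x; apply: nbrS.
      * move=> x; rewrite inE => /andP[xS sx]; rewrite nbr_sym sx /=.
        by apply: sub_all (Sp _ xS) => y; apply: nbrS.
  - apply: reach_ge => //; first by rewrite all_nseq star_cost_ge0 orbT.
    exact: reach_star.
apply: (@reach_impl _ _ (fun G => N <= #|A G|)); first exact: (core_costs_ge0 c j.+1).
  move=> G H; apply: (leq_trans H); apply: subset_leq_card; apply/subsetP => s.
  by rewrite !inE => /andP[].
by apply: loop; rewrite ?subnn.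
Qed.

End Cores.
(** * Attaching all vertices *)

Lemma card_pairs_le (T : finType) (P : {set T * T}) :
  #|P| <= 2 * #|[set [set q.1; q.2] | q in P]|.
Proof.
rewrite -sum1_card (partition_big_imset (fun q => [set q.1; q.2])) /=.
rewrite mulnC -sum_nat_const; apply: leq_sum => _ /imsetP[[a b] _ ->] /=.
rewrite sum1dep_card; apply: (@leq_trans #|[set (a, b); (b, a)]|).
  apply: subset_leq_card; apply/subsetP => -[x y]; rewrite !inE /=.
  by case/andP=> _ /eqP/set2_inj[[-> ->]|[-> ->]]; rewrite eqxx ?orbT.
by rewrite cards2; case: (_ != _).
Qed.

Section Attach.
Variables (R : realFieldType) (n N K d : nat).
Hypotheses (N_ge2 : 2 <= N) (d_leK : d <= K).
Implicit Types (F G : {set {set 'I_n}}) (v s : 'I_n).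

(** The list [p] is the top of a branch that still extends to height [K], so another attachment can
    always follow while [i < K]. *)
Definition attached F v i :=
  [exists p : i.-tuple 'I_n, extendable N F (K - i) p && all (nbr F v) p].

Definition level F v := \max_(i < d.+1 | attached F v i) i.

Definition deficit F := \sum_(v : 'I_n) (d - level F v).

Lemma attachedS F G v i : F \subset G -> attached F v i -> attached G v i.
Proof.
move=> FG /existsP[p /andP[ep vp]]; apply/existsP; exists p.
rewrite (extendableS FG ep) /=.
by apply: sub_all vp => x; apply: nbrS.
Qed.

Lemma levelS F G v : F \subset G -> level F v <= level G v.
Proof.
move=> FG; apply/bigmax_leqP => i /(attachedS FG) H.
exact: (@leq_bigmax_cond _ (fun i : 'I_d.+1 => attached G v i) (fun i => val i)).
Qed.

Lemma level_le F v : level F v <= d.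
Proof. by apply/bigmax_leqP => i _; rewrite -ltnS. Qed.

Lemma attached0 F v : extendable N F K [::] -> attached F v 0.
Proof. by move=> H; apply/existsP; exists [tuple]; rewrite subn0 H. Qed.

Lemma attached_level F v : extendable N F K [::] -> attached F v (level F v).
Proof.
move=> /(attached0 v) a0; rewrite /level.
have : 0 < #|[pred i : 'I_d.+1 | attached F v i]|.
  by apply/card_gt0P; exists ord0.
by case/(eq_bigmax_cond (fun i : 'I_d.+1 => val i)) => i ia ->.
Qed.

Lemma deficit_le F : deficit F <= d * n.
Proof.
apply: (@leq_trans (\sum_(v : 'I_n) d)); first by apply: leq_sum => v _; apply: leq_subr.
by rewrite sum_nat_const card_ord mulnC.
Qed.

Lemma deficit_drop F v s : level F v < d ->
  level F v < level (F :|: [set [set v; s]]) v ->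
  deficit (F :|: [set [set v; s]]) < deficit F.
Proof.
move=> vd lt; rewrite /deficit (bigD1 v) //= [X in _ < X](bigD1 v) //=.
rewrite -addSn leq_add //; first exact: ltn_sub2l.
by apply: leq_sum => u _; apply: leq_sub2l; apply: levelS; apply: subsetUl.
Qed.

(** The branch ends in a node with [N] children; joining [v] to any of them raises its level, and
    the loss of one accounts for [v] itself. *)
Lemma level_choices F v : extendable N F K [::] -> level F v < d ->
  N.-1 <= #|[set s | (v != s) && (level F v < level (F :|: [set [set v; s]]) v)]|.
Proof.
move=> eK vd; have /existsP[p /andP[ep vp]] := attached_level v eK.
have E : K - level F v = (K - (level F v).+1).+1.
  by rewrite -subSn ?subSS // (leq_trans vd).
rewrite E /= in ep; set S := [set s | _] in ep.
apply: (@leq_trans #|S :\ v|).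
  by move: ep; rewrite (cardsD1 v S); move: (_ \in S) => b; lia.
apply: subset_leq_card; apply/subsetP => s; rewrite !inE => /andP[sv es].
set G := F :|: _; rewrite eq_sym sv /=.
have FG : F \subset G by apply: subsetUl.
have aG : attached G v (level F v).+1.
  apply/existsP; exists [tuple of s :: p]; rewrite /= (extendableS FG es) /=.
  rewrite {1}/nbr eq_sym sv !inE eqxx orbT /=.
  by apply: sub_all vp => x; apply: nbrS.
exact: (@leq_bigmax_cond _ (fun i : 'I_d.+1 => attached G v i) (fun i => val i)
          (Ordinal (vd : (level F v).+1 < d.+1))).
Qed.

(** At least [(j + 1) / d] vertices are below level [d], each with [N - 1] choices, and an edge is
    chosen from at most its two ends. *)
Lemma deficit_choices F j : extendable N F K [::] -> deficit F = j.+1 ->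
  j.+1 * N.-1 <= 2 * d * #|[set e | is_edge e & deficit (F :|: [set e]) <= j]|.
Proof.
move=> eK Fj; pose Y := [set v | level F v < d].
pose P := [set q : 'I_n * 'I_n | (q.1 \in Y) &&
  ((q.1 != q.2) && (level F q.1 < level (F :|: [set [set q.1; q.2]]) q.1))].
have Yd : j.+1 <= d * #|Y|.
  rewrite -Fj /deficit mulnC -sum_nat_const [X in _ <= X]big_mkcond /=.
  apply: leq_sum => v _; rewrite inE; case: ltnP => [_|]; first exact: leq_subr.
  by rewrite -subn_eq0 => /eqP ->.
have YP : #|Y| * N.-1 <= #|P|.
  have -> : #|P| = \sum_(v in Y) #|[set s | (v != s) &&
                    (level F v < level (F :|: [set [set v; s]]) v)]|.
    rewrite -sum1dep_card; under [RHS]eq_bigr do rewrite -sum1dep_card.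
    by rewrite pair_big_dep.
  rewrite -sum_nat_const; apply: leq_sum => v; rewrite inE; exact: level_choices.
have PX : #|P| <= 2 * #|[set e | is_edge e & deficit (F :|: [set e]) <= j]|.
  apply: leq_trans (card_pairs_le P) _; rewrite leq_mul2l /=.
  apply: subset_leq_card; apply/subsetP => e /imsetP[[v s]].
  rewrite !inE /= => /and3P[vd vs lt] ->.
  by rewrite /is_edge cards2 vs /= -ltnS -Fj deficit_drop.
apply: leq_trans (leq_mul Yd (leqnn _)) _.
rewrite -mulnA [2 * d]mulnC -mulnA leq_mul2l; apply/orP; right.
exact: leq_trans YP PX.
Qed.

(** The count in [deficit_choices] with [N - 1] replaced by the smaller [N / 2]. *)
Definition attach_cost (j : nat) : R := ((4 * d)%:R / (j.+1 * N)%:R)%R.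

Lemma reach_attached F : extendable N F K [::] ->
  reach (fun G => [forall v, attached G v d])
    [seq attach_cost j | j <- rev (iota 0 (d * n))] F.
Proof.
move=> eF.
apply: (@reach_potential R n _ (fun G => extendable N G K [::]) deficit) => //.
- move=> j G eG Gj; have H := deficit_choices eG Gj.
  rewrite /attach_cost mulrAC ler_pdivlMr ?ltr0n ?muln_gt0 ?(ltnW N_ge2) // mul1r.
  rewrite -natrM ler_nat.
  apply: (@leq_trans (2 * (j.+1 * N.-1))); first by rewrite mulnCA leq_mul2l; lia.
  by apply: leq_trans (leq_mul (leqnn 2) H) _; rewrite !mulnA.
- by move=> j; rewrite divr_ge0.
- by move=> G e; apply: extendableS; apply: subsetUl.
- move=> G eG /eqP; rewrite sum_nat_eq0 => /forallP H; apply/forallP => v.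
  have := attached_level v eG; suff -> : level G v = d by [].
  by apply/eqP; rewrite eqn_leq level_le; have := H v; rewrite subn_eq0.
- exact: deficit_le.
Qed.

End Attach.

(** [x0] goes to [v], its neighbours to the attached list [p], and all other vertices to a
    continuation [q] of the branch. Edges away from [x0] are present because [q ++ p] is a
    clique. *)
Lemma attached_copy (V : finType) (EH : {set {set V}}) (x0 : V) n N
    (F : {set {set 'I_n}}) (v : 'I_n)
    (B := [set y | (y != x0) && ([set x0; y] \in EH)]) :
  simple_graph EH -> 2 <= N -> attached N #|V|.-1 F v #|B| ->
  exists phi : {ffun V -> 'I_n},
     [&& injectiveb phi, v \in codom phi &
         [forall e in EH, (phi @: e) \in F]].
Proof.
move=> sEH N2 /existsP[p /andP[ep vp]].
have nvp : v \notin p.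
  by apply/negP => /(allP vp); rewrite /nbr eqxx.
have [q [sq cq vq]] := extendable_avoid N2 ep nvp.
pose C := ~: (x0 |: B).
have x0B : x0 \notin B by rewrite inE eqxx.
have cC : #|C| = #|V|.-1 - #|B|.
  have := cardsC (x0 |: B); rewrite cardsU1 x0B add1n -/C.
  by lia.
(* [B] comes last, to be matched with [p] at the end of [r]. *)
pose L := enum C ++ enum B.
have uL : uniq L.
  rewrite cat_uniq !enum_uniq andbT /=; apply/hasPn => x.
  by rewrite !mem_enum !inE => ->; rewrite orbT.
have inL x : x != x0 -> x \in L.
  by move=> xx0; rewrite mem_cat !mem_enum !inE (negPf xx0) /= orNb.
pose r := q ++ p.
have sr : size r = size L.
  by rewrite !size_cat sq size_tuple -!cardE cC.
have ur : uniq r.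
  rewrite -[uniq r]/(uniq r) uniq_pairwise.
  by apply: sub_pairwise cq => x y /andP[].
have vr : v \notin r by rewrite mem_cat negb_or vq.
pose f x := if x == x0 then v else nth v r (index x L).
have fr x : x != x0 -> f x \in r.
  by move=> xx0; rewrite /f (negPf xx0) mem_nth // sr index_mem inL.
have fi : injective f.
  move=> x y; have [->|xx0] := eqVneq x x0; have [->|yx0] := eqVneq y x0 => //.
  - by rewrite {1}/f eqxx => E; move: vr; rewrite E fr.
  - by rewrite {2}/f eqxx => E; move: vr; rewrite -E fr.
  rewrite /f (negPf xx0) (negPf yx0) => /eqP.
  rewrite nth_uniq ?sr ?index_mem ?inL // => /eqP E.
  by rewrite -(nth_index x0 (inL _ xx0)) E nth_index // inL.
have fB x : x \in B -> nbr F v (f x).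
  move=> xB; apply: (allP vp).
  have xx0 : x != x0 by move: xB; rewrite inE => /andP[].
  rewrite /f (negPf xx0) /L index_cat.
  have -> : (x \in enum C) = false by rewrite mem_enum in_setC in_setU xB orbT.
  rewrite /r nth_cat sq -cardE cC ltnNge leq_addr /= addKn mem_nth //.
  by rewrite size_tuple cardE index_mem mem_enum.
have fadj x y : x != y -> x != x0 -> y != x0 -> nbr F (f x) (f y).
  move=> xy xx0 yx0; have fxy : f x != f y by rewrite (inj_eq fi).
  have /(pairwiseP v) cr := cq.
  have [lt|lt|E] := ltngtP (index (f x) r) (index (f y) r).
  - by rewrite -(nth_index v (fr _ xx0)) -(nth_index v (fr _ yx0)) cr // inE index_mem fr.
  - rewrite nbr_sym -(nth_index v (fr _ xx0)) -(nth_index v (fr _ yx0)).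
    by rewrite cr // inE index_mem fr.
  - by move/eqP: fxy; case; rewrite -(nth_index v (fr _ xx0)) E nth_index // fr.
exists (finfun f); apply/and3P; split.
- by apply/injectiveP => x y; rewrite !ffunE => /fi.
- by apply/codomP; exists x0; rewrite ffunE /f eqxx.
apply/forall_inP => e eE.
have /eqP/cards2P[x [y [xy E]]] := sEH _ eE.
have -> : [set finfun f x | x in e] = [set f x; f y].
  by rewrite E imsetU !imset_set1 !ffunE.
have fx0 : f x0 = v by rewrite /f eqxx.
have [xE|xx0] := eqVneq x x0.
  rewrite xE fx0; suff /fB/andP[] : y \in B by [].
  by rewrite inE -xE eq_sym xy -E.
have [yE|yx0] := eqVneq y x0.
  rewrite yE fx0 setUC; suff /fB/andP[] : x \in B by [].
  by rewrite inE -yE xy setUC -E.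
by have /andP[] := fadj _ _ xy xx0 yx0.
Qed.

Lemma in_PH_increasing (V : finType) (EH : {set {set V}}) n :
  increasing (@in_PH V EH n).
Proof.
move=> F G /subsetP FG /forallP H; apply/forallP => v.
have /existsP[phi /and3P[i c /forall_inP e]] := H v.
apply/existsP; exists phi; rewrite i c; apply/forall_inP => f /e; exact: FG.
Qed.

(** A vertex with fewest neighbours works: neighbours inject into incident edges, and the seed
    [#|V|] of the minimum bounds any set of vertices. *)
Lemma exists_min_nbrs (V : finType) (EH : {set {set V}}) : 0 < #|V| ->
  exists x0 : V, #|[set y | (y != x0) && ([set x0; y] \in EH)]| <= dmin EH.
Proof.
move=> /card_gt0P[z _].
pose B x := [set y | (y != x) && ([set x; y] \in EH)].
case: (arg_minnP (fun x => #|B x|) (isT : predT z)) => x0 _ mx0; exists x0.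
rewrite /dmin; elim/big_rec: _ => [|x m _ IH]; first exact: max_card.
rewrite leq_min IH andbT; apply: leq_trans (mx0 x isT) _.
have inj : {in B x &, injective (fun y => [set x; y])}.
  move=> y y'; rewrite !inE => /andP[yx _] _ /set2_inj[[_ ->]//|[E E']].
  by rewrite E' eqxx in yx.
rewrite -(card_in_imset inj); apply: subset_leq_card.
by apply/subsetP => _ /imsetP[y + ->]; rewrite !inE => /andP[_ ->]; rewrite eqxx.
Qed.
(** * Choice of parameters *)

(** The star at one vertex is a spanning tree. *)
Lemma stree_gt0 n : 0 < n -> 0 < #|{: stree n}|.
Proof.
move=> n0; pose x0 := Ordinal n0.
pose T := [set [set x0; y] | y in [set~ x0]].
suff Ts : is_spanning_tree T by apply/card_gt0P; exists (Sub T Ts).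
have inj : {in [set~ x0] &, injective (fun y => [set x0; y])}.
  by move=> y y' _ _ /set2_inj[[_ ->]|[-> ->]].
have c0 x : connect (adj T) x0 x.
  have [->|xx0] := eqVneq x x0; first exact: connect0.
  by apply: connect1; apply/imsetP; exists x; rewrite ?inE.
apply/spanning_treeP; split.
- move=> e /imsetP[y + ->]; rewrite !inE => yx0.
  by rewrite /is_edge cards2 [x0 == y]eq_sym yx0.
- by move=> x y; apply: connect_trans (c0 y); rewrite connect_adjC.
- by rewrite card_in_imset // cardsC1 card_ord.
Qed.

Lemma poly_le_exp2 a : exists l0, forall l, l0 <= l -> l ^ a <= 2 ^ l.
Proof.
(* The threshold gives [m >= a (a + 1)], so that [2 ^ m] absorbs the factor [(a + 1) ^ a]. *)
exists (a.+1 * (a * a.+1)) => l; rewrite mulnC -leq_divRL //.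
set m := l %/ a.+1 => Hm.
have lm : l <= a.+1 * m.+1 by rewrite mulnC ltnW // ltn_ceil.
have ml : m * a.+1 <= l by apply: leq_divM.
have powS x y : x <= y -> x ^ a <= y ^ a.
  by move=> xy; case: (a) => // b; rewrite leq_exp2r.
apply: leq_trans (powS _ _ lm) _; rewrite expnMn.
apply: (@leq_trans (2 ^ m * (2 ^ m) ^ a)).
  apply: leq_mul; last by rewrite powS // ltn_expl.
  apply: leq_trans (powS _ (2 ^ a.+1) _) _; first by rewrite ltnW // ltn_expl.
  by rewrite -expnM leq_exp2l // mulnC.
by rewrite -expnM -expnD leq_exp2l // -mulnS.
Qed.

(** Each dyadic block contributes at most 1. *)
Lemma harmonic_sum_le (R : realFieldType) k m : m <= 2 ^ k ->
  (\sum_(0 <= j < m) (j.+1%:R)^-1 <= k.+1%:R :> R)%R.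
Proof.
elim: k m => [|k IH] m mk.
  case: m mk => [|[|//]] _; first by rewrite big_nil.
  by rewrite big_nat1 invr1.
have [|mk'] := leqP m (2 ^ k).
  by move=> /IH H; apply: le_trans H _; rewrite ler_nat.
rewrite (big_cat_nat (n := 2 ^ k)) //=; last exact: ltnW.
rewrite -[X in (_ <= X)%R]natr1 lerD ?IH //.
apply: (@le_trans _ _ (\sum_(2 ^ k <= j < m) ((2 ^ k)%:R)^-1 : R)%R).
  apply: ler_sum_nat => j /andP[kj _]; rewrite lef_pV2 ?posrE ?ltr0n ?expn_gt0 //.
  by rewrite ler_nat ltnW.
rewrite sumr_const_nat -[X in (X <= _)%R]mulr_natl ler_pdivrMr ?ltr0n ?expn_gt0 // mul1r ler_nat.
by move: mk; rewrite expnS; lia.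
Qed.

(** * The strategy with its parameters and its failure probability *)

Section Strategy.
Variables (R : realFieldType) (V : finType) (EH : {set {set V}}) (n l d : nat).
Let K := #|V|.-1.
(** With [l] about [log n], the attachments cost [O(l / N) = O(1 / l^2)], and the exponent
    [c = K + 2] brings the clique tree down to [K / N]. The expected misses are then [O(n / l^2)],
    well below [n / l]. *)
Let N := l ^ 3.
Let c := K.+2.

Definition round_costs : seq R :=
  core_costs R N c K ++ [seq attach_cost R N d j | j <- rev (iota 0 (d * n))].

Definition builder : strategy n := greedy (@in_PH V EH n) round_costs.

Lemma round_costs_ge0 : all (fun a : R => 0 <= a)%R round_costs.
Proof.
rewrite all_cat core_costs_ge0 all_map; apply/allP => j _ /=.
by rewrite /attach_cost divr_ge0.
Qed.

Lemma reach_round_costs (x0 : V) :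
  simple_graph EH -> d = #|[set y | (y != x0) && ([set x0; y] \in EH)]| ->
  2 <= l -> N ^ (c * K) <= n -> reach (@in_PH V EH n) round_costs finset.set0.
Proof.
move=> sEH dE l2 Nn.
have N2 : 2 <= N by rewrite /N (leq_trans l2) // -{1}(expn1 l) leq_exp2l.
have dK : d <= K.
  rewrite dE /K -(cardsC1 x0); apply: subset_leq_card.
  by apply/subsetP => y; rewrite !inE => /andP[].
rewrite /round_costs reach_cat.
apply: (@reach_impl R n (fun G => extendable N G K [::])).
- exact: core_costs_ge0.
- move=> G eG.
  apply: (@reach_impl R n (fun G => [forall v, attached N K G v d])).
  + rewrite all_map; apply/allP => j _ /=.
    by rewrite /attach_cost divr_ge0.
  + move=> G' /forallP aG'; apply/forallP => v; apply/existsP.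
    by apply: (@attached_copy V EH x0 n N) => //; rewrite -dE.
  + exact: reach_attached.
- apply: (@reach_core R n N c K _ [::] [set: 'I_n]) => //.
  by rewrite cardsT card_ord.
Qed.

(** Every cost is at least [1 / N ^ (c j)], so a bound on the sum also bounds the number of
    rounds. *)
Lemma core_costs_size j : 0 < N ->
  ((size (core_costs R N c j))%:R <= (N ^ (c * j))%:R * \sum_(a <- core_costs R N c j) a)%R.
Proof.
move=> N0; have : all (fun a : R => 1 <= (N ^ (c * j))%:R * a)%R (core_costs R N c j).
  elim: j => //= j IH.
  have H : all (fun a : R => 1 <= (N ^ (c * j.+1))%:R * a)%R
      (nseq (N ^ (c * j)) (star_cost R N c j) ++ core_costs R N c j).
    rewrite all_cat all_nseq; apply/andP; split.
      apply/orP; right; rewrite /star_cost mulrCA divff ?mulr1 ?ler1n //.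
      by rewrite pnatr_eq0 -lt0n expn_gt0 N0.
    have := core_costs_ge0 R N c j; move/allP: IH => IH /allP a0.
    apply/allP => a ain; apply: (le_trans (IH _ ain)).
    by rewrite ler_wpM2r ?(a0 _ ain) // ler_nat leq_pexp2l // leq_mul2l leqnSn orbT.
  by elim: {2}N => //= m IHm; rewrite all_cat H.
elim: (core_costs _ _ _ _) => [|a s IH] /=; first by rewrite big_nil mulr0.
case/andP=> a1 /IH{}IH; rewrite big_cons mulrDr -natr1 addrC; exact: lerD.
Qed.

Lemma core_costs_sumK : 0 < l ->
  (\sum_(a <- core_costs R N c K) a <= K%:R / N%:R)%R.
Proof.
move=> l0; have N0 : 0 < N by rewrite expn_gt0 l0.
apply: le_trans (core_costs_sum R c K N0) _.
by rewrite /c [(_ ^+ K.+2)%R]exprSr invfM -mulrA mulVKf // expf_neq0 // pnatr_eq0 -lt0n.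
Qed.

Lemma round_costs_sum : 2 <= l -> n < 2 ^ l.+1 ->
  (\sum_(a <- round_costs) a <= (K + 4 * d * (d + 3))%:R / l%:R ^+ 2)%R.
Proof.
move=> l2 nl; have l0 : 0 < l by apply: ltnW.
have l0R : (0 < l%:R :> R)%R by rewrite ltr0n.
have NE : (N%:R = l%:R ^+ 3 :> R)%R by rewrite /N natrX.
have dn : d * n <= 2 ^ (d + l.+1).
  by rewrite expnD leq_mul // ltnW // ltn_expl.
have H := harmonic_sum_le R dn.
rewrite big_cat /= natrD mulrDl lerD //.
  apply: (le_trans (core_costs_sumK l0)); rewrite NE ler_wpM2l //.
  by rewrite lef_pV2 ?posrE ?exprn_gt0 // ler_weXn2l // ler1n.
rewrite big_map (perm_big _ (permEl (perm_rev _))) /=.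
have -> : (\sum_(j <- iota 0 (d * n)) attach_cost R N d j =
    (4 * d)%:R / N%:R * \sum_(0 <= j < d * n) (j.+1%:R)^-1)%R.
  rewrite mulr_sumr /index_iota subn0; apply: eq_bigr => j _.
  by rewrite /attach_cost [(j.+1 * N)%:R%R]natrM invfM [(j.+1%:R^-1 * _)%R]mulrC mulrA.
(* The harmonic sum is at most [d + l + 2], hence at most [(d + 3) l]. *)
apply: (@le_trans _ _ ((4 * d)%:R / N%:R * ((d + 3)%:R * l%:R))%R).
  rewrite ler_wpM2l ?divr_ge0 //; apply: (le_trans H).
  by rewrite -natrM ler_nat; clear -l2; nia.
rewrite NE [(4 * d * _)%:R%R]natrM le_eqVlt; apply/orP; left; apply/eqP.
by field; rewrite gt_eqF.
Qed.

Lemma round_costs_size : 2 <= l -> N ^ (c * K) <= n ->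
  size round_costs <= d * n + K * (n %/ l).+1.
Proof.
move=> l2 Nn; have l0 : 0 < l by apply: ltnW.
have l0R : (0 < l%:R :> R)%R by rewrite ltr0n.
have N0 : 0 < N by rewrite expn_gt0 l0.
rewrite /round_costs size_cat size_map size_rev size_iota addnC leq_add2l.
rewrite -(leq_pmul2r l0) -mulnA; apply: (@leq_trans (K * n)); last first.
  by rewrite leq_mul2l ltnW ?orbT // ltn_ceil.
rewrite -(ler_nat R) !natrM -ler_pdivlMr //.
apply: (le_trans (core_costs_size K N0)).
apply: (@le_trans _ _ (n%:R * (K%:R / N%:R))%R).
  rewrite ler_pM ?ler_nat ?core_costs_sumK //.
  by rewrite big_seq sumr_ge0 // => a; apply: (allP (core_costs_ge0 R N c K)).
rewrite mulrCA mulrA ler_wpM2l ?mulr_ge0 // lef_pV2 ?posrE ?ltr0n // ler_nat.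
by rewrite /N -{1}(expn1 l) leq_exp2l.
Qed.

(** Markov's inequality with about [n / l] misses allowed, against an expected number of order
    [n / l^2]. *)
Lemma missed_ratio (x0 : V) t :
  simple_graph EH -> d = #|[set y | (y != x0) && ([set x0; y] \in EH)]| ->
  2 <= l -> N ^ (c * K) <= n -> n < 2 ^ l.+1 ->
  d * n + K.+1 * (n %/ l).+1 <= t ->
  ((missed (@in_PH V EH n) builder t finset.set0)%:R <=
   (K + 4 * d * (d + 3))%:R / l%:R * #|{: stree n}|%:R ^+ t :> R)%R.
Proof.
move=> sEH dE l2 Nn nl dt.
have HR := reach_round_costs sEH dE l2 Nn.
have := @missed_bound R n _ _ (n %/ l).+1 t _ round_costs_ge0 (@in_PH_increasing V EH n) HR.
have /suffixP[p E] := stage_is_suffix (@in_PH V EH n) round_costs finset.set0.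
set s := stage _ _ _ in E *.
(* The [t] rounds cover all useful rounds and the allowed misses, so no shortage remains. *)
have -> : size s + (n %/ l).+1 - t = 0.
  apply/eqP; rewrite subn_eq0; apply: leq_trans dt.
  have := round_costs_size l2 Nn; rewrite E size_cat mulSn; lia.
have S := round_costs_sum l2 nl.
have {}S : (\sum_(a <- s) a <= (K + 4 * d * (d + 3))%:R / l%:R ^+ 2)%R.
  apply: le_trans S; rewrite E big_cat /= lerDr big_seq sumr_ge0 // => a ap.
  by have := round_costs_ge0; rewrite E all_cat => /andP[/allP/(_ _ ap)].
rewrite addr0 -/(builder).
move: S; set mis := (missed _ _ _ _)%:R%R; set T := (_ ^+ t)%R.
have : (0 <= mis :> R)%R by rewrite ler0n.
have : (0 <= (K + 4 * d * (d + 3))%:R :> R)%R by rewrite ler0n.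
move: mis (K + _)%:R%R (\sum_(a <- s) a)%R => mis C S C0 mis0 SC H.
have l0 : (0 < l%:R :> R)%R by rewrite ltr0n (ltnW l2).
have T0 : (0 <= T)%R by rewrite exprn_ge0.
have M : (n%:R / l%:R <= (n %/ l).+1%:R :> R)%R.
  by rewrite ler_pdivrMr // -natrM ler_nat ltnW // ltn_ceil // (ltnW l2).
have [n0|n0] := posnP n.
  by move: Nn; rewrite n0 leqn0 expn_eq0 /N expn_eq0; lia.
have nR : (0 < n%:R :> R)%R by rewrite ltr0n.
rewrite -(ler_pM2l (divr_gt0 nR l0)); apply: (le_trans (ler_wpM2r mis0 M)).
apply: (le_trans H).
apply: (@le_trans _ _ (T * (n%:R / 2 * (C / l%:R ^+ 2)))%R).
  by rewrite ler_wpM2l // ler_wpM2l // divr_ge0.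
have -> : (n%:R / l%:R * (C / l%:R * T) = T * (n%:R * (C / l%:R ^+ 2)))%R.
  by field; rewrite gt_eqF.
rewrite ler_wpM2l // ler_wpM2r ?divr_ge0 ?exprn_ge0 ?(ltW l0) //; lra.
Qed.

End Strategy.

(* Probabilities and limits *)
From mathcomp Require Import all_classical all_reals all_analysis.
From mathcomp Require Import Rstruct Rstruct_topology.
From Stdlib Require Import Rdefinitions.
Local Open Scope classical_set_scope.
Local Open Scope ring_scope.

(** An outcome whose graph after round [t] is in the family belongs to the event, so only missed
    outcomes can lie outside it. *)
Lemma prob_tau_le_ge (V : finType) (EH : {set {set V}}) n (sigma : strategy n) t (eps : R) :
  (0 < n)%nat ->
  (missed (@in_PH V EH n) sigma t finset.set0)%:R <= eps * #|{: stree n}|%:R ^+ t ->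
  1 - eps <= prob_tau_le EH sigma t <= 1.
Proof.
move=> n0 H; set E := tau_le_event EH sigma t.
have tot : #|{: t.-tuple (stree n)}| = expn #|{: stree n}| t by rewrite card_tuple.
have tot0 : 0 < #|{: t.-tuple (stree n)}|%:R :> R.
  by rewrite ltr0n tot expn_gt0 stree_gt0.
rewrite /prob_tau_le -/E ler_pdivrMr // mul1r ler_nat max_card andbT.
rewrite ler_pdivlMr // mulrBl mul1r lerBlDr tot natrX.
apply: (@le_trans _ _ (#|E|%:R + (missed (@in_PH V EH n) sigma t finset.set0)%:R)).
  rewrite -natrX -tot -natrD ler_nat -(cardsC E) leq_add2l.
  apply: subset_leq_card; apply/fintype.subsetP => w; rewrite !inE; apply: contra => Hw.
  apply/existsP; exists ord_max; rewrite take_oversize ?size_tuple //.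
by rewrite lerD2l.
Qed.

Lemma cvg_rate (u : nat -> R) (x C : R) :
  (forall L : nat, exists n0, forall n, (n0 <= n)%nat -> `|x - u n| <= C / L.+1%:R) ->
  u @ \oo --> x.
Proof.
move=> H; apply/(@cvgrPdist_le R R^o) => e e0.
have [n0 Hn0] := H (Num.truncn (C / e)).
exists n0 => // n /= n0n; apply: (le_trans (Hn0 _ n0n)).
rewrite ler_pdivrMr ?ltr0n // mulrC -ler_pdivrMr //; apply: ltW.
exact: truncnS_gt.
Qed.

Theorem theorem1p6 (V : finType) (EH : {set {set V}}) :
  simple_graph EH -> (0 < #|V|)%nat ->
  exists sigma : forall n : nat, strategy n,
    (forall n : nat, (2 <= n)%nat -> valid_strategy (sigma n)) /\
    exists f : nat -> nat,
      ((fun n : nat => ((f n)%:R / n%:R)%R : R) @ \oo --> (0 : R)) /\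
      ((fun n : nat => prob_tau_le EH (sigma n) (dmin EH * n + f n)%nat) @ \oo
         --> (1 : R)).
Proof.
move=> sEH V0; have [x0 x0min] := exists_min_nbrs EH V0.
move: x0min; set d := #|_| => dmin_ge.
pose lg := trunc_log 2; pose K := #|V|.-1.
exists (fun n => @builder R V EH n (lg n) d); split.
  by move=> n; apply: greedy_valid.
(* [K] shares of [n / log n] pay for the clique tree and one for the misses. *)
exists (fun n => (K.+1 * (n %/ lg n).+1)%nat).
have [l0 Hl0] := poly_le_exp2 (3 * (K.+2 * K)).
have large L : exists n0, forall n, (n0 <= n)%nat ->
    [/\ (L < lg n)%nat, (2 <= lg n)%nat, (0 < n)%nat, (n < expn 2 (lg n).+1)%nat &
        (expn (expn (lg n) 3) (K.+2 * K) <= n)%nat /\ (lg n <= n)%nat].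
  exists (expn 2 (maxn l0 (maxn 2 L.+1))) => n Hn.
  have n0 : (0 < n)%nat by apply: leq_trans Hn; rewrite expn_gt0.
  have : (maxn l0 (maxn 2 L.+1) <= lg n)%nat by apply: trunc_log_max.
  rewrite !geq_max => /and3P[h1 h2 h3].
  have /andP[b1 b2] := @trunc_log_bounds 2 n isT n0.
  split=> //; split; first by rewrite -expnM; apply: leq_trans (Hl0 _ h1) b1.
  by apply: leq_trans b1; rewrite ltnW // ltn_expl.
split.
  (* The factor 2 absorbs the rounding up of [n / lg n], as [lg n <= n]. *)
  apply: (@cvg_rate _ _ (2 * K.+1)%:R) => L; have [n0 Hn] := large L.
  exists n0 => n /Hn[Ll l2 n_gt0 _ [_ ln]].
  rewrite sub0r normrN ger0_norm ?divr_ge0 //.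
  rewrite ler_pdivrMr ?ltr0n // mulrAC ler_pdivlMr ?ltr0n // -!natrM ler_nat.
  have := leq_divM n (lg n).
  move: (n %/ lg n)%nat => q; clear -Ll ln n_gt0; nia.
apply: (@cvg_rate _ _ (K + 4 * d * (d + 3))%:R) => L; have [n0 Hn] := large L.
exists n0 => n /Hn[Ll l2 n_gt0 nl [Nn _]].
have := @missed_ratio R V EH n (lg n) d x0 (dmin EH * n + K.+1 * (n %/ lg n).+1) sEH erefl l2 Nn nl.
rewrite leq_add2r leq_mul2r dmin_ge orbT => /(_ isT) H.
have /andP[p1 p2] := prob_tau_le_ge n_gt0 H.
rewrite ger0_norm ?subr_ge0 // lerBlDr -lerBlDl.
apply: le_trans p1; rewrite lerB // ler_wpM2l // lef_pV2 ?posrE ?ltr0n ?(ltnW l2) //.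
by rewrite ler_nat.
Qed.
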